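(* Let $R$ be a ring and let $F$ be a field. Then for every $n\in\mathbb N$: $$c_n(R\otimes_{\mathbb Z}F,\,F)=\begin{cases} c_n(R/\operatorname{Tor}R,\,0) & \text{if } \operatorname{char}F=0,\\ c_n(R/pR,\,p) & \text{if } \operatorname{char}F=p>0,\end{cases}$$ where $\operatorname{Tor}R:=\{r\in R\mid mr=0\text{ for some }m\in\mathbb N\}$ is the torsion of $R$.
   Context: Rings and algebras are associative, not necessarily with unit; $\mathbb N=\{1,2,\dots\}$. $\mathbb Z\langle X\rangle$ is the free associative ring without $1$ on $X=\{x_1,x_2,\dots\}$ (noncommutative integer polynomials without constant term). For a ring $R$, $\operatorname{Id}(R,\mathbb Z)\subseteq\mathbb Z\langle X\rangle$ is the set of $f$ with $f(a_1,\dots,a_n)=0$ for all $a_i\in R$ (polynomial identities of $R$ with integer coefficients). $P_n(\mathbb Z)$ is the additive subgroup of $\mathbb Z\langle X\rangle$ generated by the monomials $x_{\sigma(1)}\cdots x_{\sigma(n)}$, $\sigma\in S_n$. The codimensions $c_n(R,q)$, for $q=0$ or $q$ a prime power $p^k$ ($p$ prime, $k\in\mathbb N$), are the multiplicities in the decomposition of the finitely generated abelian group $$\frac{P_n(\mathbb Z)}{P_n(\mathbb Z)\cap\operatorname{Id}(R,\mathbb Z)}\cong \mathbb Z^{c_n(R,0)}\oplus\bigoplus_{p\text{ prime}}\bigoplus_{k\in\mathbb N}(\mathbb Z/p^k\mathbb Z)^{c_n(R,p^k)}.$$ For an algebra $A$ over a field $F$, $\operatorname{Id}(A,F)\subseteq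 F\langle X\rangle$ is the set of polynomial identities of $A$ with coefficients in $F$, $P_n(F)$ is the $F$-subspace of $F\langle X\rangle$ generated by $x_{\sigma(1)}\cdots x_{\sigma(n)}$, $\sigma\in S_n$, and $c_n(A,F):=\dim_F\frac{P_n(F)}{P_n(F)\cap\operatorname{Id}(A,F)}$. *)

(* Defs.v *)
From HB Require Import structures.
From mathcomp Require Import all_boot perm all_algebra.
From mathcomp Require Import boolp classical_sets.
From mathcomp Require Import finmap monalg.

Set Implicit Arguments.
Unset Strict Implicit.
Unset Printing Implicit Defensive.

Import GRing.Theory.
Local Open Scope ring_scope.
Local Open Scope quotient_scope.

Reserved Notation "x ** y" (at level 40, left associativity).

HB.mixin Record Zmodule_isNuRing R of GRing.Zmodule R := {
  numul : R -> R -> R;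
  numulA : associative numul;
  numulDl : left_distributive numul +%R;
  numulDr : right_distributive numul +%R
}.

#[short(type="nuRingType")]
HB.structure Definition NuRing := {R of GRing.Zmodule R & Zmodule_isNuRing R}.

Notation "x ** y" := (numul x y) : ring_scope.

HB.mixin Record NuRing_isNuAlgebra (k : comNzRingType) A
    of GRing.Lmodule k A & NuRing A := {
  nuscalerAl : forall (c : k) (x y : A), c *: (x ** y) = (c *: x) ** y;
  nuscalerAr : forall (c : k) (x y : A), c *: (x ** y) = x ** (c *: y)
}.

#[short(type="nuAlgType")]
HB.structure Definition NuAlgebra (k : comNzRingType) :=
  {A of GRing.Lmodule k A & NuRing A & NuRing_isNuAlgebra k A}.

Section NuRingTheory.
Variable R : nuRingType.
Implicit Types x y z : R.

Lemma numul0r x : 0 ** x = 0.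
Proof. by apply: (addrI (0 ** x)); rewrite -numulDl !addr0. Qed.

Lemma numulr0 x : x ** 0 = 0.
Proof. by apply: (addrI (x ** 0)); rewrite -numulDr !addr0. Qed.

Lemma numulNr x y : (- x) ** y = - (x ** y).
Proof. by apply: (addrI (x ** y)); rewrite -numulDl !subrr numul0r. Qed.

Lemma numulrN x y : x ** (- y) = - (x ** y).
Proof. by apply: (addrI (x ** y)); rewrite -numulDr !subrr numulr0. Qed.

Lemma numulBl x y z : (x - y) ** z = x ** z - y ** z.
Proof. by rewrite numulDl numulNr. Qed.

Lemma numulBr x y z : x ** (y - z) = x ** y - x ** z.
Proof. by rewrite numulDr numulrN. Qed.

Lemma numulMnl x y n : (x *+ n) ** y = (x ** y) *+ n.
Proof. by elim: n => [|n IH]; rewrite ?numul0r // !mulrS numulDl IH. Qed.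

Lemma numulMnr x y n : x ** (y *+ n) = (x ** y) *+ n.
Proof. by elim: n => [|n IH]; rewrite ?numulr0 // !mulrS numulDr IH. Qed.

Lemma numulMzl x y m : (x *~ m) ** y = (x ** y) *~ m.
Proof. by case: m => n; rewrite ?NegzE ?mulrNz ?numulNr -!pmulrn numulMnl. Qed.

Lemma numulMzr x y m : x ** (y *~ m) = (x ** y) *~ m.
Proof. by case: m => n; rewrite ?NegzE ?mulrNz ?numulrN -!pmulrn numulMnr. Qed.

End NuRingTheory.

(** A ring is regarded as an algebra over the integers through the library's
    alias [zmodule], so that identities over [int] and over a field are instances
    of one definition. *)

HB.instance Definition _ (R : nuRingType) := NuRing.copy (zmodule R) R.

Fact zmodule_scalerAl (R : nuRingType) (c : int) (x y : zmodule R) :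
  c *: (x ** y) = (c *: x) ** y.
Proof. by rewrite !scalezrE numulMzl. Qed.

Fact zmodule_scalerAr (R : nuRingType) (c : int) (x y : zmodule R) :
  c *: (x ** y) = x ** (c *: y).
Proof. by rewrite !scalezrE numulMzr. Qed.

HB.instance Definition _ (R : nuRingType) :=
  NuRing_isNuAlgebra.Build int (zmodule R)
    (@zmodule_scalerAl R) (@zmodule_scalerAr R).

Section LmodQuotient.
Variables (k : pzRingType) (V : lmodType k) (W : submodClosed V).

Fact submod_zmod_closed : zmod_closed (W : {pred V}).
Proof.
by split=> [|x y Wx Wy]; rewrite ?rpred0 // -scaleN1r rpredD ?rpredZ.
Qed.

(** [submodClosed] does not inherit from [zmodClosed], which the library's
    quotient takes. *)
Definition submod_zmod : zmodClosed V :=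
  HB.pack_for (zmodClosed V) (W : {pred V})
    (GRing.isZmodClosed.Build V (W : {pred V}) submod_zmod_closed).

Definition lmod_quot : Type := Quotient.quot submod_zmod.

HB.instance Definition _ := GRing.Zmodule.on lmod_quot.

Definition lmod_pi (x : V) : lmod_quot := \pi_(Quotient.quot submod_zmod) x.

Definition lmod_quot_scale (c : k) (x : lmod_quot) : lmod_quot :=
  lmod_pi (c *: repr x).

Fact lmod_piE x y : (lmod_pi x = lmod_pi y) <-> (x - y \in W).
Proof.
have -> := Quotient.idealrBE submod_zmod x y.
by split=> [e|/eqP //]; apply/eqP.
Qed.

Fact lmod_pi_is_zmod_morphism : zmod_morphism lmod_pi.
Proof. by move=> x y; rewrite /lmod_pi raddfB. Qed.

Fact lmod_piK (x : lmod_quot) : lmod_pi (repr x) = x.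
Proof. exact: reprK. Qed.

Fact lmod_quot_scale_pi c x : lmod_quot_scale c (lmod_pi x) = lmod_pi (c *: x).
Proof.
apply/lmod_piE; rewrite -scalerBr rpredZ //.
by apply/lmod_piE; rewrite lmod_piK.
Qed.

Fact lmod_quot_scalerA a b (x : lmod_quot) :
  lmod_quot_scale a (lmod_quot_scale b x) = lmod_quot_scale (a * b) x.
Proof. by rewrite -(lmod_piK x) !lmod_quot_scale_pi scalerA. Qed.

Fact lmod_quot_scale1r : left_id 1 lmod_quot_scale.
Proof. by move=> x; rewrite -(lmod_piK x) lmod_quot_scale_pi scale1r. Qed.

Fact lmod_piD x y : lmod_pi (x + y) = lmod_pi x + lmod_pi y.
Proof. by rewrite /lmod_pi raddfD. Qed.

Fact lmod_quot_scalerDr : right_distributive lmod_quot_scale +%R.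
Proof.
move=> c x y; rewrite -(lmod_piK x) -(lmod_piK y) -lmod_piD.
by rewrite !lmod_quot_scale_pi scalerDr lmod_piD.
Qed.

Fact lmod_quot_scalerDl (x : lmod_quot) :
  {morph lmod_quot_scale^~ x : a b / a + b}.
Proof.
move=> a b; rewrite -(lmod_piK x) !lmod_quot_scale_pi.
by rewrite scalerDl lmod_piD.
Qed.

HB.instance Definition _ := GRing.Zmodule_isLmodule.Build k lmod_quot
  lmod_quot_scalerA lmod_quot_scale1r lmod_quot_scalerDr lmod_quot_scalerDl.

Fact lmod_pi_is_scalable : scalable lmod_pi.
Proof. by move=> c x; rewrite -lmod_quot_scale_pi. Qed.

HB.instance Definition _ :=
  GRing.isZmodMorphism.Build V lmod_quot lmod_pi lmod_pi_is_zmod_morphism.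
HB.instance Definition _ :=
  GRing.isScalable.Build k V lmod_quot *:%R lmod_pi lmod_pi_is_scalable.

End LmodQuotient.

HB.mixin Record isNuIdeal (R : nuRingType) (I : R -> bool) := {
  nuideall : forall x y : R, y \in (I : {pred R}) -> x ** y \in (I : {pred R});
  nuidealr : forall x y : R, x \in (I : {pred R}) -> x ** y \in (I : {pred R})
}.

#[short(type="nuIdeal")]
HB.structure Definition NuIdeal (R : nuRingType) :=
  {I of GRing.ZmodClosed R I & isNuIdeal R I}.

Section NuRingQuotient.
Variables (R : nuRingType) (I : nuIdeal R).

Definition nu_quot : Type := Quotient.quot I.

HB.instance Definition _ := GRing.Zmodule.on nu_quot.

Definition nu_pi (x : R) : nu_quot := \pi_(Quotient.quot I) x.

Definition nu_quot_mul (x y : nu_quot) : nu_quot := nu_pi (repr x ** repr y).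

Fact nu_piE x y : (nu_pi x = nu_pi y) <-> (x - y \in I).
Proof.
have -> := Quotient.idealrBE I x y.
by split=> [e|/eqP //]; apply/eqP.
Qed.

Fact nu_piK (x : nu_quot) : nu_pi (repr x) = x.
Proof. exact: reprK. Qed.

Fact nu_pi_is_zmod_morphism : zmod_morphism nu_pi.
Proof. by move=> x y; rewrite /nu_pi raddfB. Qed.

HB.instance Definition _ :=
  GRing.isZmodMorphism.Build R nu_quot nu_pi nu_pi_is_zmod_morphism.

Fact nu_quot_mul_pi x y : nu_quot_mul (nu_pi x) (nu_pi y) = nu_pi (x ** y).
Proof.
apply/nu_piE; set x' := repr _; set y' := repr _.
have -> : x' ** y' - x ** y = (x' - x) ** y' + x ** (y' - y).
  by rewrite numulBl numulBr addrA subrK.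
by apply: rpredD; [apply: nuidealr | apply: nuideall];
   apply/nu_piE; rewrite nu_piK.
Qed.

Fact nu_quot_mulA : associative nu_quot_mul.
Proof.
move=> x y z; rewrite -(nu_piK x) -(nu_piK y) -(nu_piK z).
by rewrite !nu_quot_mul_pi numulA.
Qed.

Fact nu_quot_mulDl : left_distributive nu_quot_mul +%R.
Proof.
move=> x y z; rewrite -(nu_piK x) -(nu_piK y) -(nu_piK z).
by rewrite -raddfD !nu_quot_mul_pi numulDl raddfD.
Qed.

Fact nu_quot_mulDr : right_distributive nu_quot_mul +%R.
Proof.
move=> x y z; rewrite -(nu_piK x) -(nu_piK y) -(nu_piK z).
by rewrite -raddfD !nu_quot_mul_pi numulDr raddfD.
Qed.

HB.instance Definition _ := Zmodule_isNuRing.Build nu_quot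
  nu_quot_mulA nu_quot_mulDl nu_quot_mulDr.

Fact nu_piM : {morph nu_pi : x y / x ** y}.
Proof. by move=> x y; rewrite -nu_quot_mul_pi. Qed.

End NuRingQuotient.

Section Torsion.
Variable R : nuRingType.

Definition torsion : {pred R} :=
  fun r => `[< exists m : nat, (0 < m)%N /\ r *+ m = 0 >].

Fact torsion_zmod_closed : zmod_closed torsion.
Proof.
split=> [|x y /asboolP[m [m0 xm]] /asboolP[n [n0 yn]]].
  by apply/asboolP; exists 1%N.
apply/asboolP; exists (m * n)%N; split; first by rewrite muln_gt0 m0.
by rewrite mulrnBl mulrnA xm mul0rn mulnC mulrnA yn mul0rn subr0.
Qed.

HB.instance Definition _ :=
  GRing.isZmodClosed.Build R torsion torsion_zmod_closed.

Fact torsion_ideall x y : y \in torsion -> x ** y \in torsion.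
Proof.
case/asboolP=> m [m0 ym]; apply/asboolP; exists m; split=> //.
by rewrite -numulMnr ym numulr0.
Qed.

Fact torsion_idealr x y : x \in torsion -> x ** y \in torsion.
Proof.
case/asboolP=> m [m0 xm]; apply/asboolP; exists m; split=> //.
by rewrite -numulMnl xm numul0r.
Qed.

HB.instance Definition _ :=
  isNuIdeal.Build R torsion torsion_ideall torsion_idealr.

End Torsion.
Arguments torsion R : clear implicits.

Section Multiples.
Variables (R : nuRingType) (p : nat).

Definition multiples : {pred R} := fun r => `[< exists s : R, r = s *+ p >].

Fact multiples_zmod_closed : zmod_closed multiples.
Proof.
split=> [|_ _ /asboolP[x ->] /asboolP[y ->]]; apply/asboolP.
  by exists 0; rewrite mul0rn.
by exists (x - y); rewrite mulrnBl.
Qed.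

HB.instance Definition _ :=
  GRing.isZmodClosed.Build R multiples multiples_zmod_closed.

Fact multiples_ideall x y : y \in multiples -> x ** y \in multiples.
Proof.
by case/asboolP=> s ->; apply/asboolP; exists (x ** s); rewrite numulMnr.
Qed.

Fact multiples_idealr x y : x \in multiples -> x ** y \in multiples.
Proof.
by case/asboolP=> s ->; apply/asboolP; exists (s ** y); rewrite numulMnl.
Qed.

HB.instance Definition _ :=
  isNuIdeal.Build R multiples multiples_ideall multiples_idealr.

End Multiples.
Arguments multiples R p : clear implicits.

Definition mod_torsion (R : nuRingType) : nuRingType := nu_quot (torsion R).

Definition mod_prime (R : nuRingType) (p : nat) : nuRingType :=
  nu_quot (multiples R p).

Section FreeAbelianGroup.
Variables (K : choiceType) (V : zmodType).

Definition free_lift (h : K -> V) (u : {malg int[K]}) : V :=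
  \sum_(x <- msupp u) h x *~ u@_x.

Fact free_liftEw (h : K -> V) (d : {fset K}) u :
  (msupp u `<=` d)%fset -> free_lift h u = \sum_(x <- d) h x *~ u@_x.
Proof.
move=> le; rewrite [LHS](big_fset_incl _ le) // => x _ /mcoeff_outdom ->.
by rewrite mulr0z.
Qed.

Fact free_lift_is_zmod_morphism (h : K -> V) : zmod_morphism (free_lift h).
Proof.
move=> u v; set d := (msupp u `|` msupp v)%fset.
rewrite (@free_liftEw h d u) ?fsubsetUl // (@free_liftEw h d v) ?fsubsetUr //.
rewrite (@free_liftEw h d (u - v)) ?msuppB_le // -sumrB.
by apply: eq_bigr => x _; rewrite mcoeffB mulrzBr.
Qed.

HB.instance Definition _ (h : K -> V) :=
  GRing.isZmodMorphism.Build {malg int[K]} V (free_lift h)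
    (free_lift_is_zmod_morphism h).

Fact free_liftU (h : K -> V) x : free_lift h << x >> = h x.
Proof. by rewrite (free_liftEw _ msuppU_le) big_seq_fset1 mcoeffUU. Qed.

End FreeAbelianGroup.

Fact free_ind (K : choiceType) (P : {malg int[K]} -> Prop) :
  P 0 -> (forall u v, P u -> P v -> P (u - v)) -> (forall x, P << x >>) ->
  forall u, P u.
Proof.
move=> P0 PB PU u.
have PN v : P v -> P (- v) by move=> Pv; rewrite -sub0r; apply: PB.
have PD v w : P v -> P w -> P (v + w).
  by move=> Pv Pw; rewrite -[w]opprK; apply/PB/PN.
have Pn x n : P << n%:Z *g x >>.
  elim: n => [|n IH]; first by rewrite monalgU0.
  by rewrite intS monalgUD; apply: PD.
rewrite (monalgE u); elim: (enum_fset _) => [|x s IH]; first by rewrite big_nil.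
rewrite big_cons; apply: PD => //; case: (u@_x) => n; first exact: Pn.
by rewrite NegzE monalgUN; apply/PN/Pn.
Qed.

Section Tensor.
Variables M N : zmodType.

(** The subgroup of the free abelian group on [M * N] generated by the
    biadditivity relations; these already imply that the tensor is balanced
    over the integers. *)
Inductive tensor_rel : {malg int[(M * N)%type]} -> Prop :=
| TensorRel0 : tensor_rel 0
| TensorRelB u v : tensor_rel u -> tensor_rel v -> tensor_rel (u - v)
| TensorRelDl x y a :
    tensor_rel (<< (x + y, a) >> - << (x, a) >> - << (y, a) >>)
| TensorRelDr x a b :
    tensor_rel (<< (x, a + b) >> - << (x, a) >> - << (x, b) >>).

Definition tensor_relb : {pred {malg int[(M * N)%type]}} :=
  fun u => `[< tensor_rel u >].

Fact tensor_relb_zmod_closed : zmod_closed tensor_relb.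
Proof.
split=> [|u v /asboolP ru /asboolP rv]; apply/asboolP.
  exact: TensorRel0.
exact: TensorRelB.
Qed.

HB.instance Definition _ :=
  GRing.isZmodClosed.Build _ tensor_relb tensor_relb_zmod_closed.

Definition tensor : Type := Quotient.quot tensor_relb.

HB.instance Definition _ := GRing.Zmodule.on tensor.

Definition tensor_pi (u : {malg int[(M * N)%type]}) : tensor := \pi_(Quotient.quot tensor_relb) u.

Fact tensor_pi_is_zmod_morphism : zmod_morphism tensor_pi.
Proof. by move=> x y; rewrite /tensor_pi raddfB. Qed.

HB.instance Definition _ :=
  GRing.isZmodMorphism.Build _ tensor tensor_pi tensor_pi_is_zmod_morphism.

Fact tensor_piE u v : (tensor_pi u = tensor_pi v) <-> tensor_rel (u - v).
Proof.
have -> : tensor_rel (u - v) <-> (u - v \in tensor_relb).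
  by split=> [?|/asboolP//]; apply/asboolP.
have -> := Quotient.idealrBE tensor_relb u v.
by split=> [e|/eqP //]; apply/eqP.
Qed.

Fact tensor_piK (t : tensor) : tensor_pi (repr t) = t.
Proof. exact: reprK. Qed.

Definition pure (x : M) (a : N) : tensor := tensor_pi << (x, a) >>.

Fact pureDl x y a : pure (x + y) a = pure x a + pure y a.
Proof.
by apply/eqP; rewrite -subr_eq0 opprD addrA -!raddfB /= -(raddf0 tensor_pi);
   apply/eqP/tensor_piE; rewrite subr0; apply: TensorRelDl.
Qed.

Fact pureDr x a b : pure x (a + b) = pure x a + pure x b.
Proof.
by apply/eqP; rewrite -subr_eq0 opprD addrA -!raddfB /= -(raddf0 tensor_pi);
   apply/eqP/tensor_piE; rewrite subr0; apply: TensorRelDr.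
Qed.

Fact tensor_ind (P : tensor -> Prop) :
  P 0 -> (forall s t, P s -> P t -> P (s - t)) -> (forall x a, P (pure x a)) ->
  forall t, P t.
Proof.
move=> P0 PB PU t; rewrite -(tensor_piK t); move: (repr t).
apply: free_ind => [|u v Pu Pv|[x a]]; last exact: PU.
  by rewrite raddf0.
by rewrite raddfB; apply: PB.
Qed.

(** The additive map induced by a biadditive [b]; only meaningful for such [b] *)
Definition tensor_lift (V : zmodType) (b : M -> N -> V) (t : tensor) : V :=
  free_lift (fun xa => b xa.1 xa.2) (repr t).

Definition biadditive (V : zmodType) (b : M -> N -> V) : Prop :=
  (forall x y a, b (x + y) a = b x a + b y a) /\
  (forall x a a', b x (a + a') = b x a + b x a').

Section Lift.
Variables (V : zmodType) (b : M -> N -> V).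
Hypothesis bP : biadditive b.

Fact tensor_lift_pi u :
  tensor_lift b (tensor_pi u) = free_lift (fun xa => b xa.1 xa.2) u.
Proof.
apply/eqP; rewrite -subr_eq0 -raddfB /=; apply/eqP.
have : tensor_rel (repr (tensor_pi u) - u).
  by apply/tensor_piE; rewrite tensor_piK.
elim=> [|v w _ IHv _ IHw|x y a|x a a']; first exact: raddf0.
- by rewrite raddfB /= IHv IHw subr0.
- by rewrite !raddfB /= !free_liftU /= bP.1 -addrA -opprD subrr.
- by rewrite !raddfB /= !free_liftU /= bP.2 -addrA -opprD subrr.
Qed.

Fact tensor_lift_pure x a : tensor_lift b (pure x a) = b x a.
Proof. by rewrite tensor_lift_pi free_liftU. Qed.

Fact tensor_lift_is_zmod_morphism : zmod_morphism (tensor_lift b).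
Proof.
move=> s t; rewrite -(tensor_piK s) -(tensor_piK t) -raddfB.
by rewrite !tensor_lift_pi raddfB.
Qed.

Fact tensor_liftB s t : tensor_lift b (s - t) = tensor_lift b s - tensor_lift b t.
Proof. exact: tensor_lift_is_zmod_morphism. Qed.

Fact tensor_lift0 : tensor_lift b 0 = 0.
Proof. by rewrite -[0 in LHS](subrr 0) tensor_liftB subrr. Qed.

Fact tensor_liftD s t : tensor_lift b (s + t) = tensor_lift b s + tensor_lift b t.
Proof.
by rewrite -[t in LHS]opprK -[- t in LHS]sub0r !tensor_liftB tensor_lift0 sub0r opprK.
Qed.

End Lift.

End Tensor.

Fact tensor_lift_ext (M N V : zmodType) (b b' : M -> N -> V) t :
  (forall x a, b x a = b' x a) -> tensor_lift b t = tensor_lift b' t.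
Proof.
by move=> e; rewrite /tensor_lift /free_lift; apply: eq_bigr => -[x a] _; rewrite e.
Qed.

(** The [F]-algebra [R (x)_Z F]: [(r (x) a) (s (x) b) = rs (x) ab] and
    [c (r (x) a) = r (x) ca]. *)

Section TensorAlgebra.
Variables (R : nuRingType) (F : comNzRingType).

Definition tensor_alg : Type := tensor R F.

HB.instance Definition _ := GRing.Zmodule.on tensor_alg.

Implicit Types s t u : tensor_alg.

Definition tensor_mul s t : tensor_alg :=
  tensor_lift (fun r a => tensor_lift (fun r' b => pure (r ** r') (a * b)) t) s.

Definition tensor_scale (c : F) t : tensor_alg :=
  tensor_lift (fun r a => pure r (c * a)) t.

Fact tensor_mul_biadd_r (r : R) (a : F) :
  biadditive (fun r' b => pure (r ** r') (a * b)).
Proof. by split=> *; rewrite ?numulDr ?mulrDr (pureDl, pureDr). Qed.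

Fact tensor_mul_biadd_l t :
  biadditive
    (fun (r : R) (a : F) =>
       tensor_lift (fun r' b => pure (r ** r') (a * b)) t).
Proof.
split=> [x y a|x a a'].
  elim/tensor_ind: t => [|t1 t2 IH1 IH2|r b].
  - by rewrite !tensor_lift0 ?addr0 //; apply: tensor_mul_biadd_r.
  - rewrite !tensor_liftB; try exact: tensor_mul_biadd_r.
    by rewrite IH1 IH2 opprD addrACA.
  - rewrite !tensor_lift_pure; try exact: tensor_mul_biadd_r.
    by rewrite numulDl pureDl.
elim/tensor_ind: t => [|t1 t2 IH1 IH2|r b].
- by rewrite !tensor_lift0 ?addr0 //; apply: tensor_mul_biadd_r.
- rewrite !tensor_liftB; try exact: tensor_mul_biadd_r.
  by rewrite IH1 IH2 opprD addrACA.
- rewrite !tensor_lift_pure; try exact: tensor_mul_biadd_r.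
  by rewrite mulrDl pureDr.
Qed.

Fact tensor_mul_pure (r r' : R) (a a' : F) :
  tensor_mul (pure r a) (pure r' a') = pure (r ** r') (a * a').
Proof.
rewrite /tensor_mul tensor_lift_pure; last exact: tensor_mul_biadd_l.
by rewrite tensor_lift_pure //; apply: tensor_mul_biadd_r.
Qed.

Fact tensor_mulBl s t u : tensor_mul (s - t) u = tensor_mul s u - tensor_mul t u.
Proof. exact/tensor_liftB/tensor_mul_biadd_l. Qed.

Fact tensor_mul0l u : tensor_mul 0 u = 0.
Proof. exact/tensor_lift0/tensor_mul_biadd_l. Qed.

Fact tensor_mul0r u : tensor_mul u 0 = 0.
Proof.
elim/tensor_ind: u => [|s t IHs IHt|r a]; first exact: tensor_mul0l.
  by rewrite tensor_mulBl IHs IHt subrr.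
rewrite /tensor_mul tensor_lift_pure; last exact: tensor_mul_biadd_l.
exact/tensor_lift0/tensor_mul_biadd_r.
Qed.

Fact tensor_mulBr u s t : tensor_mul u (s - t) = tensor_mul u s - tensor_mul u t.
Proof.
elim/tensor_ind: u => [|u v IHu IHv|r a].
- by rewrite !tensor_mul0l subrr.
- by rewrite !tensor_mulBl IHu IHv !opprD addrACA.
rewrite /tensor_mul !tensor_lift_pure; try exact: tensor_mul_biadd_l.
exact/tensor_liftB/tensor_mul_biadd_r.
Qed.

Fact tensor_mulDl : left_distributive tensor_mul +%R.
Proof.
move=> s t u; rewrite -[t in LHS]opprK tensor_mulBl.
by rewrite -[- t in LHS]sub0r tensor_mulBl tensor_mul0l sub0r opprK.
Qed.

Fact tensor_mulDr : right_distributive tensor_mul +%R.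
Proof.
move=> s t u; rewrite -[u in LHS]opprK tensor_mulBr.
by rewrite -[- u in LHS]sub0r tensor_mulBr tensor_mul0r sub0r opprK.
Qed.

Fact tensor_mulA : associative tensor_mul.
Proof.
move=> s t u.
elim/tensor_ind: s => [|s s' IH IH'|x a]; first by rewrite !tensor_mul0l.
  by rewrite !tensor_mulBl IH IH'.
elim/tensor_ind: t => [|t t' IH IH'|y b].
- by rewrite tensor_mul0r !tensor_mul0l tensor_mul0r.
- by rewrite tensor_mulBl !tensor_mulBr tensor_mulBl IH IH'.
elim/tensor_ind: u => [|u u' IH IH'|z c]; first by rewrite !tensor_mul0r.
  by rewrite !tensor_mulBr IH IH'.
by rewrite !tensor_mul_pure numulA mulrA.
Qed.

HB.instance Definition _ :=
  Zmodule_isNuRing.Build tensor_alg tensor_mulA tensor_mulDl tensor_mulDr.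

Fact tensor_scale_biadd (c : F) : biadditive (fun (r : R) a => pure r (c * a)).
Proof. by split=> *; rewrite ?mulrDr (pureDl, pureDr). Qed.

Fact tensor_scale_pure (c : F) (r : R) (a : F) :
  tensor_scale c (pure r a) = pure r (c * a).
Proof. exact/tensor_lift_pure/tensor_scale_biadd. Qed.

Fact tensor_scaleBr c s t : tensor_scale c (s - t) = tensor_scale c s - tensor_scale c t.
Proof. exact/tensor_liftB/tensor_scale_biadd. Qed.

Fact tensor_scale0r c : tensor_scale c 0 = 0.
Proof. exact/tensor_lift0/tensor_scale_biadd. Qed.

Fact tensor_scalerA c d t : tensor_scale c (tensor_scale d t) = tensor_scale (c * d) t.
Proof.
elim/tensor_ind: t => [|s t IHs IHt|r a]; first by rewrite !tensor_scale0r.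
  by rewrite !tensor_scaleBr IHs IHt.
by rewrite !tensor_scale_pure mulrA.
Qed.

Fact tensor_scale1r : left_id 1 tensor_scale.
Proof.
elim/tensor_ind=> [|s t IHs IHt|r a]; first by rewrite !tensor_scale0r.
  by rewrite !tensor_scaleBr IHs IHt.
by rewrite !tensor_scale_pure mul1r.
Qed.

Fact tensor_scalerDr : right_distributive tensor_scale +%R.
Proof. by move=> c s t; apply/tensor_liftD/tensor_scale_biadd. Qed.

Fact tensor_scalerDl t : {morph tensor_scale^~ t : c d / c + d}.
Proof.
move=> c d; elim/tensor_ind: t => [|s t IHs IHt|r a].
- by rewrite !tensor_scale0r addr0.
- by rewrite !tensor_scaleBr IHs IHt opprD addrACA.
by rewrite !tensor_scale_pure mulrDl pureDr.
Qed.

HB.instance Definition _ := GRing.Zmodule_isLmodule.Build F tensor_alg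
  tensor_scalerA tensor_scale1r tensor_scalerDr tensor_scalerDl.

Fact tensor_scalerAl (c : F) s t : c *: (s ** t) = (c *: s) ** t.
Proof.
change (tensor_scale c (tensor_mul s t) = tensor_mul (tensor_scale c s) t).
elim/tensor_ind: s => [|s s' IH IH'|x a].
- by rewrite tensor_scale0r !tensor_mul0l tensor_scale0r.
- by rewrite tensor_scaleBr !tensor_mulBl tensor_scaleBr IH IH'.
elim/tensor_ind: t => [|t t' IH IH'|y b].
- by rewrite !tensor_mul0r tensor_scale0r.
- by rewrite !tensor_mulBr tensor_scaleBr IH IH'.
by rewrite tensor_mul_pure !tensor_scale_pure tensor_mul_pure mulrA.
Qed.

Fact tensor_scalerAr (c : F) s t : c *: (s ** t) = s ** (c *: t).
Proof.
change (tensor_scale c (tensor_mul s t) = tensor_mul s (tensor_scale c t)).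
elim/tensor_ind: s => [|s s' IH IH'|x a].
- by rewrite !tensor_mul0l tensor_scale0r.
- by rewrite !tensor_mulBl tensor_scaleBr IH IH'.
elim/tensor_ind: t => [|t t' IH IH'|y b].
- by rewrite tensor_scale0r !tensor_mul0r tensor_scale0r.
- by rewrite tensor_scaleBr !tensor_mulBr tensor_scaleBr IH IH'.
by rewrite tensor_mul_pure !tensor_scale_pure tensor_mul_pure mulrCA.
Qed.

HB.instance Definition _ :=
  NuRing_isNuAlgebra.Build F tensor_alg tensor_scalerAl tensor_scalerAr.

End TensorAlgebra.

(** [{malg k[{fmonom nat}]}] is the free associative [k]-algebra with unit on
    countably many variables, indexed from 0; the free algebra without unit is
    its ideal of elements without constant term. *)
Notation ncpoly k := {malg k[{fmonom nat}]}.

Section Identities.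
Variables (k : comNzRingType) (A : nuAlgType k).

(** The value at the empty word is irrelevant: evaluation is only used on
    polynomials without constant term. *)
Definition word_eval (a : nat -> A) (w : seq nat) : A :=
  if w is i :: w' then foldl (fun x j => x ** a j) (a i) w' else 0.

Definition nc_eval (a : nat -> A) (f : ncpoly k) : A :=
  \sum_(w <- msupp f) f@_w *: word_eval a w.

Fact nc_evalEw a (d : {fset {fmonom nat}}) (f : ncpoly k) :
  (msupp f `<=` d)%fset -> nc_eval a f = \sum_(w <- d) f@_w *: word_eval a w.
Proof.
move=> le; rewrite [LHS](big_fset_incl _ le) // => x _ /mcoeff_outdom ->.
by rewrite scale0r.
Qed.

Fact nc_eval_is_linear a : linear (nc_eval a).
Proof.
move=> c f g; set d := (msupp f `|` msupp g)%fset.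
rewrite (@nc_evalEw a d f) ?fsubsetUl // (@nc_evalEw a d g) ?fsubsetUr //.
rewrite (@nc_evalEw a d (c *: f + g)).
  rewrite scaler_sumr -big_split /=; apply: eq_bigr => w _.
  by rewrite mcoeffD mcoeffZ scalerDl scalerA.
apply: fsubset_trans (msuppD_le _ _) _.
by apply: fsetUSS => //; apply: msuppZ_le.
Qed.

HB.instance Definition _ a :=
  GRing.isLinear.Build k (ncpoly k) A *:%R (nc_eval a) (nc_eval_is_linear a).

Definition poly_id : {pred ncpoly k} :=
  fun f => `[< f@_(mone : {fmonom nat}) = 0 /\
               forall a : nat -> A, nc_eval a f = 0 >].

Fact poly_id_submod_closed : submod_closed poly_id.
Proof.
split=> [|c f g /asboolP[f0 fP] /asboolP[g0 gP]]; apply/asboolP.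
  by split=> [|a]; rewrite ?mcoeff0 ?linear0.
split=> [|a]; first by rewrite mcoeffD mcoeffZ f0 g0 mulr0 addr0.
by rewrite linearP /= fP gP scaler0 addr0.
Qed.

HB.instance Definition _ :=
  GRing.isSubmodClosed.Build k (ncpoly k) poly_id poly_id_submod_closed.

End Identities.

Section Multilinear.
Variables (k : comNzRingType) (n : nat).

(** [x_(s 0) x_(s 1) ... x_(s n.-1)] *)
Definition perm_monom (s : 'S_n) : ncpoly k :=
  << FMonom [seq val (s i) | i <- enum 'I_n] >>.

(** [P_n(k)] *)
Definition multilinear : {pred ncpoly k} :=
  fun f => `[< exists c : 'S_n -> k, f = \sum_s c s *: perm_monom s >].

Fact multilinear_submod_closed : submod_closed multilinear.
Proof.
split=> [|a _ _ /asboolP[c ->] /asboolP[d ->]]; apply/asboolP.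
  by exists (fun=> 0); rewrite big1 // => s _; rewrite scale0r.
exists (fun s => a * c s + d s).
rewrite scaler_sumr -big_split; apply: eq_bigr => s _.
by rewrite scalerDl scalerA.
Qed.

HB.instance Definition _ :=
  GRing.isSubmodClosed.Build k (ncpoly k) multilinear multilinear_submod_closed.

Record mlpoly := MLPoly {ml_val : ncpoly k; _ : ml_val \in multilinear}.

HB.instance Definition _ := [isSub for ml_val].
HB.instance Definition _ := [Choice of mlpoly by <:].
HB.instance Definition _ := [SubChoice_isSubLmodule of mlpoly by <:].

End Multilinear.

Section MultilinearIdentities.
Variables (k : comNzRingType) (A : nuAlgType k) (n : nat).

Definition ml_id : {pred mlpoly k n} := fun f => ml_val f \in poly_id A.

Fact ml_id_submod_closed : submod_closed ml_id.
Proof.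
split=> [|c f g fP gP]; rewrite unfold_in /=; first exact: rpred0.
by apply: rpredD => //; apply: rpredZ.
Qed.

HB.instance Definition _ :=
  GRing.isSubmodClosed.Build k (mlpoly k n) ml_id ml_id_submod_closed.

Definition ml_quot : lmodType k := lmod_quot ml_id.

End MultilinearIdentities.

Definition cyclic_group (q : nat) : zmodType :=
  if q is 0 then int else 'Z_q.

Definition prime_power (q : nat) : Prop :=
  exists p m : nat, [/\ prime p, (0 < m)%N & q = (p ^ m)%N].

(** [M] is isomorphic to the direct sum of the [(Z/qZ)^(c q)], for [q] zero or
    a prime power; the direct sum is the group of finitely supported families.
    Requiring [c] to vanish elsewhere makes the other factors trivial. *)
Definition cyclic_decomposition (M : zmodType) (c : nat -> nat) : Prop :=
  (forall q, q <> 0%N -> ~ prime_power q -> c q = 0%N) /\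
  exists phi : forall q : nat, {additive M -> 'rV[cyclic_group q]_(c q)},
    (forall x, (forall q, phi q x = 0) -> x = 0) /\
    (forall y : forall q : nat, 'rV[cyclic_group q]_(c q),
       (exists x, forall q, phi q x = y q) <->
       (exists N : nat, forall q, (N <= q)%N -> y q = 0)).

(** Every finitely generated abelian group has such a decomposition, and the
    decomposition determines [c], so the default value is never used. *)
Definition codim_ring (R : nuRingType) (n q : nat) : nat :=
  xget (fun=> 0%N)
    [set c | cyclic_decomposition (ml_quot (zmodule R) n) c]%classic q.

(** The spaces measured here are finite-dimensional: [ml_quot A n] is spanned by
    [n`!] elements. *)
Definition dimension (F : fieldType) (V : lmodType F) : nat :=
  xget 0%N
    [set d | exists f : {linear V -> 'rV[F]_d}, bijective f]%classic.

Definition codim_alg (F : fieldType) (A : nuAlgType F) (n : nat) : nat :=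
  dimension (ml_quot A n).

(* Main.v *)
Require Import Defs.
From HB Require Import structures.
From mathcomp Require Import all_boot perm all_algebra.
From mathcomp Require Import boolp classical_sets finmap monalg.

(** Both characteristics are treated at once.  Let [q] be the characteristic of
    [F], so that an integer vanishes in [F] iff [q] divides it, and let [I] be
    the torsion of [R] if [q = 0], and [q R] otherwise.  Write [N] for [n`!] and
    identify a multilinear polynomial with the vector of its [N] coefficients.
    The identities of [R / I] form a subgroup [L] of [Z^N]; those of
    [R (x) F] form a subspace [W] of [F^N].  The theorem says that [Z^N / L]
    is [(Z/q)^d] and that [F^N / W] is [F^d] for the same [d].

    The lattice [L] contains [q Z^N] and is saturated: if [q] does not divide
    [m] and [m c] is in [L], then [c] is.  By the Smith normal form there are
    coordinates on [Z^N] in which [L] consists of the vectors whose coordinates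
    with index in some set [J] are divisible by [q] ([lattice_coordinates]).
    Hence [Z^N / L] is [(Z/q)^#|J|].  It remains to prove that [W] is cut out,
    in the same coordinates, by the vanishing of the coordinates in [J].

    By multilinearity, [c] is in [W] iff the sums
    [\sum_s (r_(s 1) ... r_(s n)) (x) c_s] vanish for all choices of the [r_i]
    in [R] ([ml_eval_tensorP]).  Since [x (x) 1] vanishes for [x] in [I], the
    images in [F^N] of the vectors of [L] lie in [W] ([int_relation_tensor]);
    this gives one inclusion.  For the other one, let [c] be in [W] and let [v]
    be an integer column with [l v] divisible by [q] for all [l] in [L]; one
    needs [c v = 0] ([tensor_relation_ortho]).  If [e = c v] were not zero, there
    would be an additive functional from [F] to its prime field with value 1 at
    [e].  Applied to the second tensor factors, and after multiplication by a
    common denominator, it turns the vanishing of the tensors into an integer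
    vector [k] of [L] with [k v] not divisible by [q], a contradiction.  To treat
    all characteristics alike, the functional is represented by its kernel, a
    subgroup [H] of [F] that is maximal for containing no multiple of [e] by an
    integer not divisible by [q] ([maximal_avoiding]): its value at [x] is the
    fraction [k / m] if [m x - k e] is in [H].

    Finally [codim_ring] and [dimension] are shown to read off the exponent from
    any one decomposition ([cyclic_multiplicity], [dimension_eq]). *)

Set Implicit Arguments.
Unset Strict Implicit.
Unset Printing Implicit Defensive.

Import GRing.Theory.
Local Open Scope ring_scope.

(** * Powers of [Z] and of [Z/p] *)

Definition cyc_gen (q : nat) : cyclic_group q :=
  if q is q'.+1 then (1 : 'Z_(q'.+1)) else (1 : int).

(** The value [q = 1] is excluded because the cyclic group [Z/1Z] is represented
    by ['Z_1], which has two elements. *)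
Lemma cyc_gen_eq0 q (m : int) :
  q != 1%N -> (cyc_gen q *~ m == 0) = (q%:Z %| m)%Z.
Proof.
case: q => [|[|q]] // _; first by rewrite /= intz dvd0z.
rewrite /cyc_gen; change ((m%:~R == 0 :> 'Z_q.+2) = (q.+2%:Z %| m)%Z).
have h (k : nat) : (k%:R == 0 :> 'Z_q.+2) = (q.+2 %| k)%N.
  by rewrite -(inj_eq val_inj) /= val_Zp_nat // /dvdn.
by case: m => k; rewrite ?NegzE ?mulrNz ?oppr_eq0 -pmulrn h ?dvdzN.
Qed.

Lemma cyc_gen_surj q (x : cyclic_group q) : exists m : int, x = cyc_gen q *~ m.
Proof.
case: q x => [x|q x]; first by exists x; rewrite /= intz.
by exists (x : nat)%:Z; rewrite -pmulrn /= natr_Zp.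
Qed.

Lemma mxMzE (V : zmodType) m n (M : 'M[V]_(m, n)) (k : int) i j :
  (M *~ k) i j = M i j *~ k.
Proof. by case: k => k; rewrite ?NegzE ?mulrNz ?mxE -!pmulrn ?mulmxnE. Qed.

(** The hypothesis says that [q] is the characteristic of [F]; it is used in this
    form so that [q = 0] and [q] prime need not be distinguished. *)
Section CharField.
Variables (F : fieldType) (q : nat).
Hypothesis charF : forall m : int, (m%:~R == 0 :> F) = (q%:Z %| m)%Z.

Lemma char_neq1 : q != 1%N.
Proof. by apply/eqP => q1; have := charF 1; rewrite q1 oner_eq0 dvd1z. Qed.

Lemma char_dvdM (m k : int) : (q%:Z %| m * k)%Z = (q%:Z %| m)%Z || (q%:Z %| k)%Z.
Proof. by rewrite -!charF intrM mulf_eq0. Qed.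

Lemma cyc_gen_eq0F (m : int) : (cyc_gen q *~ m == 0) = (m%:~R == 0 :> F).
Proof. by rewrite charF cyc_gen_eq0 // char_neq1. Qed.

Lemma cyc_gen_eqF (m k : int) :
  cyc_gen q *~ m = cyc_gen q *~ k -> m%:~R = k%:~R :> F.
Proof.
move/eqP; rewrite -subr_eq0 -mulrzBr cyc_gen_eq0F intrD intrN subr_eq0.
by move/eqP.
Qed.

(** Lift [g] and a section of it on the standard generators to integer
    matrices: their product is the identity modulo [q], hence the identity over
    [F], where ranks are available. *)
Lemma cyclic_pow_surj_leq d e
    (g : {additive 'rV[cyclic_group q]_d -> 'rV[cyclic_group q]_e}) :
  (forall y, exists x, g x = y) -> (e <= d)%N.
Proof.
move=> gsurj.
pose unit k i : 'rV[cyclic_group q]_k := \row_j (cyc_gen q *+ (i == j)).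
have unitE k (v : 'I_k -> int) :
    \row_j (cyc_gen q *~ v j) = \sum_i unit k i *~ v i.
  apply/rowP => j; rewrite !mxE summxE (bigD1 j) //= big1 => [|i ij].
    by rewrite mxMzE mxE eqxx addr0.
  by rewrite mxMzE mxE (negPf ij) mul0rz.
have lift k (x : 'rV[cyclic_group q]_k) :
    exists v : 'I_k -> int, x = \row_j (cyc_gen q *~ v j).
  have /choice [v vP] : forall j, exists m : int, x 0 j = cyc_gen q *~ m.
    by move=> j; apply: cyc_gen_surj.
  by exists v; apply/rowP => j; rewrite mxE vP.
have /choice [A AP] : forall i, exists v : 'I_e -> int,
    g (unit d i) = \row_j (cyc_gen q *~ v j) by move=> i; apply: lift.
have /choice [B BP] : forall j, exists v : 'I_d -> int,
    g (\row_i (cyc_gen q *~ v i)) = unit e j.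
  by move=> j; have [x <-] := gsurj (unit e j); have [v ->] := lift d x; exists v.
apply: (@mulmx1_min F _ _ (\matrix_(j, i) (B j i)%:~R) (\matrix_(i, j) (A i j)%:~R)).
apply/matrixP => j l; rewrite !mxE.
under eq_bigr do rewrite !mxE -intrM.
transitivity ((\sum_i B j i * A i l)%:~R : F); first by rewrite rmorph_sum.
transitivity (((j == l) : nat)%:Z%:~R : F); last by rewrite -pmulrn.
apply: cyc_gen_eqF; have /rowP/(_ l) := BP j.
rewrite unitE raddf_sum !mxE summxE => e0.
rewrite -pmulrn -e0 mulrz_sumr; apply: eq_bigr => i _.
rewrite raddfMz AP mulrC mulrzA.
by rewrite mxMzE mxE.
Qed.

Lemma cyclic_pow_annihilator d (x : 'rV[cyclic_group q]_d) (m : int) :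
  x != 0 -> (x *~ m == 0) = (q%:Z %| m)%Z.
Proof.
move=> x0; have [j xj] : exists j, x 0 j != 0.
  apply: contrapT => h; move/eqP: x0; apply; apply/rowP => j; rewrite mxE.
  by apply/eqP/negPn/negP => xj; apply: h; exists j.
have [k xk] := cyc_gen_surj (x 0 j).
have nk : ~~ (q%:Z %| k)%Z by rewrite -charF -cyc_gen_eq0F -xk.
apply/eqP/idP => [/rowP/(_ j)|/dvdzP[l ->]].
  rewrite mxMzE xk mxE -mulrzA => /eqP.
  by rewrite cyc_gen_eq0F charF char_dvdM (negPf nk).
apply/rowP => i; rewrite mxMzE mxE; have [s ->] := cyc_gen_surj (x 0 i).
rewrite -mulrzA; apply/eqP; rewrite cyc_gen_eq0 ?char_neq1 //.
by rewrite dvdz_mull // dvdz_mull.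
Qed.

(** * Multiplicities and dimensions *)

Section Decomposition.
Variables (M : zmodType) (d : nat) (f : {additive M -> 'rV[cyclic_group q]_d}).
Hypothesis fbij : bijective f.

Lemma cyclic_decomposition_single :
  (q = 0%N \/ prime_power q) ->
  cyclic_decomposition M (fun r => if r == q then d else 0%N).
Proof.
move=> qP; split=> [r r0 nr|].
  by case: eqP => // e; case: qP; rewrite -e.
have phiP r :
    {phi : {additive M -> 'rV[cyclic_group r]_(if r == q then d else 0%N)} |
      r = q -> bijective phi}.
  have [-> | rq] := eqVneq r q; first by exists f.
  exists (@GRing.null_fun M _ : {additive M -> 'rV[cyclic_group r]_0%N}) => e.
  by rewrite e eqxx in rq.
exists (fun r => sval (phiP r)); split=> [x /(_ q) xq|y].
  have [g gK _] := svalP (phiP q) erefl.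
  by rewrite -[x]gK xq -(raddf0 (sval (phiP q))) gK.
split=> [_|_].
  exists q.+1 => r qr; apply/rowP => -[j jlt]; exfalso.
  by move: jlt; rewrite gtn_eqF.
have [g _ gK] := svalP (phiP q) erefl; exists (g (y q)) => r.
have [-> // | /eqP/negPf rq] := pselect (r = q).
by apply/rowP => -[j jlt]; exfalso; move: jlt; rewrite rq.
Qed.

(** A nonzero summand [Z/rZ] contains an element with annihilator [rZ], whereas
    every nonzero element of [(Z/q)^d] has annihilator [qZ]; so only [r = q]
    occurs, and the exponents agree by [cyclic_pow_surj_leq] in both
    directions. *)
Lemma cyclic_decomposition_mult c : cyclic_decomposition M c -> c q = d.
Proof.
case=> cP [phi [phi_inj phi_surj]].
have [g fK gK] := fbij.
have f0 x : (f x == 0) = (x == 0).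
  by rewrite -[x in RHS]fK -(inj_eq (can_inj gK)) fK -(raddf0 f) fK.
have realize r (v : 'rV[cyclic_group r]_(c r)) :
    exists x, phi r x = v /\ forall s, s != r -> phi s x = 0.
  (* the family equal to [v] at [r] and to 0 elsewhere *)
  pose y s : 'rV[cyclic_group s]_(c s) :=
    if eqVneq s r is EqNotNeq e then
      ecast r' ('rV[cyclic_group r']_(c r')) (esym e) v else 0.
  have [_] := phi_surj y; case=> [|x xP].
    exists r.+1 => s rs; rewrite /y; case: eqVneq => // e.
    by rewrite e ltnn in rs.
  exists x; split=> [|s sr]; rewrite xP /y.
    by case: eqVneq => [e|]; [rewrite (eq_axiomK e) | rewrite eqxx].
  by case: eqVneq sr.
have c0 r : r != q -> c r = 0%N.
  move=> rq; apply: contrapT => /eqP; rewrite -lt0n => cr.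
  have r1 : r != 1%N.
    apply/eqP => r1; move: cr; rewrite cP // r1 // => -[p [m [pp m0]]].
    by apply/eqP; rewrite neq_ltn -(exp1n m) ltn_exp2r // prime_gt1 ?orbT.
  have [x [xr xs]] := realize r (const_mx (cyc_gen r)).
  have annx m : (x *~ m == 0) = (r%:Z %| m)%Z.
    rewrite -(cyc_gen_eq0 _ r1); apply/eqP/eqP => [xm|gm].
      have : phi r (x *~ m) = 0 by rewrite xm raddf0.
      by rewrite raddfMz xr => /rowP/(_ (Ordinal cr)); rewrite mxMzE !mxE.
    apply: phi_inj => s; rewrite raddfMz; have [->|sr] := eqVneq s r.
      by rewrite xr; apply/rowP => j; rewrite mxMzE !mxE.
    by rewrite xs // mul0rz.
  have x0 : f x != 0.
    rewrite f0 -[x]mulr1z annx; apply: contra r1.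
    by rewrite dvdz1.
  have annq m : (r%:Z %| m)%Z = (q%:Z %| m)%Z.
    by rewrite -annx -f0 raddfMz cyclic_pow_annihilator.
  move/negP: rq; apply; rewrite eqn_dvd.
  rewrite -[(r %| q)%N]/(r%:Z %| q%:Z)%Z annq dvdzz.
  by rewrite -[(q %| r)%N]/(q%:Z %| r%:Z)%Z -annq dvdzz.
have phi0 x : phi q x = 0 -> x = 0.
  move=> xq; apply: phi_inj => s; have [-> //|sq] := eqVneq s q.
  by apply/rowP => -[j jlt]; exfalso; move: jlt; rewrite c0.
have phi_onto v : exists x, phi q x = v by have [x [xq _]] := realize q v; exists x.
have [h hP] := choice phi_onto.
have phi_can x : h (phi q x) = x.
  by apply/eqP; rewrite -subr_eq0; apply/eqP/phi0; rewrite raddfB hP subrr.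
have gB : zmod_morphism g by apply: can2_zmod_morphism fK gK.
have hB : zmod_morphism h by apply: can2_zmod_morphism phi_can hP.
pose gA := GRing.isZmodMorphism.Build _ _ g gB.
pose hA := GRing.isZmodMorphism.Build _ _ h hB.
pose g' : {additive 'rV[cyclic_group q]_d -> M} := HB.pack g gA.
pose h' : {additive 'rV[cyclic_group q]_(c q) -> M} := HB.pack h hA.
apply/eqP; rewrite eqn_leq; apply/andP; split.
  apply: (@cyclic_pow_surj_leq _ _ (phi q \o g')) => y.
  by exists (f (h y)); rewrite /= fK hP.
apply: (@cyclic_pow_surj_leq _ _ (f \o h')) => y.
by exists (phi q (g y)); rewrite /= phi_can gK.
Qed.

Lemma cyclic_multiplicity :
  (q = 0%N \/ prime_power q) ->
  xget (fun=> 0%N) [set c | cyclic_decomposition M c]%classic q = d.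
Proof.
move=> qP; apply: cyclic_decomposition_mult.
apply: (@xgetPex _ _ [set c | cyclic_decomposition M c]%classic).
by eexists; apply: cyclic_decomposition_single qP.
Qed.

End Decomposition.

Lemma dimension_eq (V : lmodType F) d (f : {linear V -> 'rV[F]_d}) :
  bijective f -> dimension V = d.
Proof.
move=> fbij.
have le a b (g : {linear V -> 'rV[F]_a}) (h : {linear V -> 'rV[F]_b}) :
    bijective g -> bijective h -> (a <= b)%N.
  move=> [g' gK g'K] [h' hK h'K].
  have g'L : linear g' by apply: can2_linear gK g'K.
  have h'L : linear h' by apply: can2_linear hK h'K.
  pose g'' : {linear 'rV[F]_a -> V} := HB.pack g' (GRing.isLinear.Build _ _ _ _ g' g'L).
  pose h'' : {linear 'rV[F]_b -> V} := HB.pack h' (GRing.isLinear.Build _ _ _ _ h' h'L).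
  apply: (@mulmx1_min F _ _ (lin1_mx (h \o g'')) (lin1_mx (g \o h''))).
  apply/row_matrixP => i; rewrite row_mul !rowE mulmx1 !mul_rV_lin1 /=.
  by rewrite hK g'K.
rewrite /dimension; apply: xget_unique; first by exists f.
move=> e [g gbij]; apply/eqP.
by rewrite eqn_leq (le _ _ _ _ gbij fbij) (le _ _ _ _ fbij gbij).
Qed.

(** * Saturated lattices of integer vectors *)

Section Lattice.
Variables (N : nat) (L : 'rV[int]_N -> Prop).
Hypothesis LB : forall u v, L u -> L v -> L (u - v).
Hypothesis Lq : forall u, L (q%:Z *: u).
Hypothesis Lsat : forall (m : int) u, ~~ (q%:Z %| m)%Z -> L (m *: u) -> L u.

Lemma lattice0 : L 0. Proof. by rewrite -(scaler0 _ q%:Z); apply: Lq. Qed.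

Lemma latticeD u v : L u -> L v -> L (u + v).
Proof.
by move=> Lu Lv; rewrite -[v]opprK; apply: LB => //; rewrite -sub0r; apply/LB/Lv/lattice0.
Qed.

Lemma latticeZ m u : L u -> L (m *: u).
Proof.
have Ln k w : L w -> L (w *+ k).
  move=> Lw; elim: k => [|k IH]; first exact: lattice0.
  by rewrite mulrS; apply: latticeD.
move=> Lu; rewrite -[m]intz scaler_int; case: m => k; first exact: Ln.
by rewrite NegzE mulrNz -pmulrn -sub0r; apply/LB/Ln/Lu/lattice0.
Qed.

Lemma lattice_mul k (v : 'rV_k) (G : 'M_(k, N)) :
  (forall i, L (row i G)) -> L (v *m G).
Proof.
move=> LG; rewrite mulmx_sum_row; elim/big_rec: _ => [|i w _ Lw].
  exact: lattice0.
by apply: latticeD => //; apply: latticeZ.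
Qed.

(** Take an integer matrix [G] with rows in [L] and of maximal rank over [F], and
    its Smith form [U D S].  The rows of [D S] are in [L], so that, by saturation,
    [L] contains the rows of [S] whose elementary divisor is not divisible by [q].
    By maximality of the rank, the vectors of [L] are, over [F], combinations of
    these rows only.  So the required coordinates are those in the rows of
    [S]. *)
Lemma lattice_coordinates :
  exists (P : 'M[int]_N) (J : {set 'I_N}), P \in unitmx /\
    forall c, L c <-> forall i, i \in J -> (q%:Z %| (c *m P) 0%R i)%Z.
Proof.
pose toF k (G : 'M[int]_(k, N)) : 'M[F]_(k, N) := map_mx intr G.
pose Q r := `[< exists k (G : 'M[int]_(k, N)),
  (forall i, L (row i G)) /\ \rank (toF k G) = r >].
have [|r|r /asboolP[k [G [LG rG]]] rmax] := @ex_maxnP Q N.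
- exists 0%N; apply/asboolP; exists 0%N, (0 : 'M_(0, N)).
  by split=> [[]//|]; apply/eqP; rewrite /toF map_mx0 mxrank0.
- by move=> /asboolP[k [G [_ <-]]]; apply: rank_leq_col.
have [U Uunit [S Sunit [d _ GE]]] := int_Smith_normal_form G.
pose D := \matrix_(i < k, j < N) (d`_i *+ (i == j :> nat)).
have {}GE : G = U *m D *m S by [].
(* a column of [D] beyond its last row is zero, so its index belongs to [J] *)
pose J := [set i : 'I_N | (i < k)%N ==> (q%:Z %| d`_i)%Z].
have LS j : j \notin J -> L (row j S).
  rewrite inE negb_imply => /andP[jk qd]; apply: (Lsat qd).
  have -> : d`_j *: row j S = row (Ordinal jk) (invmx U) *m G.
    rewrite -row_mul GE -mulmxA mulKmx // row_mul.
    rewrite mulmx_sum_row (bigD1 j) //= big1 => [|i ij]; last first.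
      by rewrite !mxE /= eq_sym (negPf (ij : i != j :> nat)) mulr0n scale0r.
    by rewrite !mxE /= eqxx addr0.
  exact: lattice_mul.
exists (invmx S), J; split=> [|c]; first by rewrite unitmx_inv.
split=> [Lc i|qc].
  rewrite inE => qi.
  have cG : (toF 1%N c <= toF k G)%MS.
    pose H := col_mx G c.
    have GH : (toF k G <= toF _ H)%MS.
      by rewrite /toF map_col_mx; apply: submx_trans (addsmxSl _ _) _; rewrite addsmxE.
    have cH : (toF 1%N c <= toF _ H)%MS.
      by rewrite /toF map_col_mx; apply: submx_trans (addsmxSr _ _) _; rewrite addsmxE.
    apply: submx_trans cH _; rewrite -(mxrank_leqif_sup GH) eqn_leq mxrankS //= rG.
    apply: rmax; apply/asboolP; exists (k + 1)%N, H; split=> // j.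
    rewrite /H -(splitK j); case: (split j) => l /=.
      by rewrite rowKu.
    by rewrite rowKd row_id.
  have [u uE] := submxP cG.
  have cP : toF 1%N (c *m invmx S) = u *m map_mx intr U *m toF k D.
    rewrite /toF map_mxM -/(toF _ c) uE GE /toF !map_mxM -!mulmxA.
    by rewrite -map_mxM mulmxV // map_mx1 mulmx1.
  move/rowP/(_ i): cP; rewrite mxE -charF => ->.
  rewrite mxE big1 // => j _; rewrite !mxE; case: eqP => [ji|_]; last by rewrite mulr0.
  suff -> : (d`_j *+ true)%:~R = 0 :> F by rewrite mulr0.
  by apply/eqP; rewrite charF ji (implyP qi) // -ji.
rewrite -(mulmxKV Sunit c) mulmx_sum_row; elim/big_rec: _ => [|i w _ Lw].
  exact: lattice0.
apply: latticeD => //; have [iJ|iJ] := boolP (i \in J); last exact/latticeZ/LS.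
by have /dvdzP[l ->] := qc i iJ; rewrite mulrC -scalerA; apply: Lq.
Qed.

End Lattice.

(** * Functionals from a field to its prime field *)

Section PrimeFunctional.
Variable e : F.
Hypothesis e0 : e != 0.

(** By Zorn, take [H] maximal among the subgroups with the third property.  If no
    multiple [m x] with [m] not divisible by [q] were congruent to a multiple of
    [e] modulo [H], then [x] would not be in [H], and the subgroup generated by
    [H] and [x] would have the same property. *)
Lemma maximal_avoiding : exists H : set F,
  [/\ H 0, forall x y, H x -> H y -> H (x - y),
      forall m : int, H (e *~ m) -> (q%:Z %| m)%Z &
      forall x, exists m k : int, ~~ (q%:Z %| m)%Z /\ H (x *~ m - e *~ k)].
Proof.
have em0 (x : F) (m : int) : x != 0 -> (x *~ m == 0) = (q%:Z %| m)%Z.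
  by move=> x0; rewrite -mulrzr mulf_eq0 (negPf x0) charF.
(* the empty set is good too, so that chains, even the empty one, have unions *)
pose good (H : set F) := (forall x y, H x -> H y -> H (x - y)) /\
  (forall m : int, H (e *~ m) -> (q%:Z %| m)%Z).
have [C Cgood Ctot|H [[HB He] Hmax]] := @Zorn_bigcup _ good.
  split=> [x y [X CX Xx] [Y CY Yy]|m [X CX Xm]]; last first.
    by case: (Cgood X CX) => _; apply.
  have [XY|YX] := Ctot X Y CX CY.
    by exists Y => //; case: (Cgood Y CY) => + _; apply=> //; apply: XY.
  by exists X => //; case: (Cgood X CX) => + _; apply=> //; apply: YX.
have H0 : H 0.
  apply: contrapT => nH0.
  have Hempty x : ~ H x by move=> Hx; apply: nH0; rewrite -(subrr x); apply: HB.
  apply: (Hmax [set 0]%classic).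
    by split=> [x /Hempty//|]; move=> /(_ 0 erefl)/Hempty.
  split=> [x y -> ->|m /eqP]; first by rewrite /= subrr.
  by rewrite em0.
exists H; split=> // x; apply: contrapT => noH.
have nH (m k : int) : ~~ (q%:Z %| m)%Z -> ~ H (x *~ m - e *~ k).
  by move=> qm Hm; apply: noH; exists m, k.
pose G := [set u | exists h (m : int), H h /\ u = h + x *~ m]%classic.
apply: (Hmax G); first split.
- by move=> h Hh; exists h, 0; rewrite addr0.
- move=> GH; have : ~ H (x *~ 1 - e *~ 0).
    by apply: nH; rewrite -charF oner_eq0.
  by rewrite subr0; apply; apply: GH; exists 0, 1; rewrite add0r.
split=> [_ _ [h [m [Hh ->]]] [h' [m' [Hh' ->]]]|k [h [m [Hh ek]]]].
  by exists (h - h'), (m - m'); split; [apply: HB | rewrite mulrzBr opprD addrACA].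
have [qm|qm] := boolP (q%:Z %| m)%Z; last first.
  by case: (nH m k qm); rewrite ek opprD addrCA subrr addr0 -sub0r; apply: HB.
have xm : x *~ m = 0.
  by have [->|x0] := eqVneq x 0; [rewrite mul0rz | apply/eqP; rewrite em0].
by apply: He; rewrite ek xm addr0.
Qed.

(* From here on, [H] is a subgroup as provided by [maximal_avoiding]. *)
Variables (H : set F) (R : nuRingType).
Hypothesis H0 : H 0.
Hypothesis HB : forall x y, H x -> H y -> H (x - y).
Hypothesis He : forall m : int, H (e *~ m) -> (q%:Z %| m)%Z.
Hypothesis Hfrac :
  forall x, exists m k : int, ~~ (q%:Z %| m)%Z /\ H (x *~ m - e *~ k).

(** The functional with kernel [H] and value 1 at [e] has value [k / m] at [x]. *)
Definition frac_at (x : F) (m k : int) : Prop := H (x *~ m - e *~ k).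

Lemma avoidingD x y : H x -> H y -> H (x + y).
Proof. by move=> Hx Hy; rewrite -[y]opprK; apply/HB => //; rewrite -sub0r; apply: HB. Qed.

Lemma avoidingMz x (m : int) : H x -> H (x *~ m).
Proof.
have Hn k : H x -> H (x *+ k).
  by move=> Hx; elim: k => // k IH; rewrite mulrS; apply: avoidingD.
case: m => k Hx; first exact: Hn.
by rewrite NegzE mulrNz -pmulrn -sub0r; apply/HB => //; apply: Hn.
Qed.

Lemma frac_atM x m k l : frac_at x m k -> frac_at x (m * l) (k * l).
Proof. by move=> xm; rewrite /frac_at !mulrzA -mulrzBl; apply: avoidingMz. Qed.

Lemma frac_atD x y m k l :
  frac_at x m k -> frac_at y m l -> frac_at (x + y) m (k + l).
Proof.
move=> xm ym; rewrite /frac_at mulrzDl mulrzDr opprD addrACA; exact: avoidingD.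
Qed.

Lemma frac_at_uniq x m k l : frac_at x m k -> frac_at x m l -> (q%:Z %| k - l)%Z.
Proof.
move=> xk xl; apply: He; rewrite mulrzBr.
have -> : e *~ k - e *~ l = (x *~ m - e *~ l) - (x *~ m - e *~ k).
  by rewrite opprB [RHS]addrC addrA subrK.
exact: HB.
Qed.

(** A relation between tensors involves finitely many elements of [F].  Once [m]
    clears the denominators of their values under the functional, [g] is, up to
    multiples of [q], additive on them, so that the relation is mapped into
    [q R].  The factor [l] allows a common denominator for several relations. *)
Lemma tensor_rel_frac (u : {malg int[(R * F)%type]}) : tensor_rel u ->
  exists m : int, ~~ (q%:Z %| m)%Z /\
    forall l : int, ~~ (q%:Z %| l)%Z -> forall g : F -> int,
      (forall a k, frac_at a (m * l) k -> frac_at a (m * l) (g a)) ->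
      exists s : R, free_lift (fun xa => xa.1 *~ g xa.2) u = s *+ q.
Proof.
have q1 : ~~ (q%:Z %| 1)%Z by rewrite -charF oner_eq0.
have qM m l : ~~ (q%:Z %| m)%Z -> ~~ (q%:Z %| l)%Z -> ~~ (q%:Z %| m * l)%Z.
  by move=> qm ql; rewrite char_dvdM negb_or qm.
elim=> [|{}u v _ [m [qm IHu]] _ [m' [qm' IHv]]|x y a|x a b].
- by exists 1; split=> // l _ g _; exists 0; rewrite raddf0 mul0rn.
- exists (m * m'); split=> [|l ql g gP]; first exact: qM.
  have [s us] := IHu (m' * l) (qM _ _ qm' ql) g ltac:(by rewrite mulrA).
  have [t vt] := IHv (m * l) (qM _ _ qm ql) g ltac:(by rewrite mulrCA mulrA).
  by exists (s - t); rewrite raddfB /= us vt mulrnBl.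
- exists 1; split=> // l _ g _; exists 0.
  by rewrite !raddfB /= !free_liftU /= mulrzDl -addrA -opprD subrr mul0rn.
have [m [k [qm am]]] := Hfrac a; have [m' [k' [qm' bm']]] := Hfrac b.
exists (m * m'); split=> [|l ql g gP]; first exact: qM.
have {}am : frac_at a (m * m' * l) (k * (m' * l)) by rewrite -mulrA; apply: frac_atM.
have {}bm' : frac_at b (m * m' * l) (k' * (m * l)).
  by rewrite [m * m']mulrC -mulrA; apply: frac_atM.
have /dvdzP[t tE] : (q%:Z %| g (a + b) - (g a + g b))%Z.
  apply: frac_at_uniq (gP _ _ (frac_atD am bm')) _.
  by apply: frac_atD; [apply: gP am | apply: gP bm'].
exists (x *~ t); rewrite !raddfB /= !free_liftU /=.
by rewrite -addrA -opprD -mulrzDr -mulrzBr tE mulrzA.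
Qed.

(** The map [id (x) functional] sends the vanishing tensor to
    [\sum_i y_i * (k_i / m)]; the denominator [l] depends on the relation that
    makes the tensor vanish. *)
Lemma tensor_sum_frac (I : finType) (y : I -> R) (c : I -> F) (m : int) (k : I -> int) :
    ~~ (q%:Z %| m)%Z -> (forall i, frac_at (c i) m (k i)) ->
    \sum_i pure (y i) (c i) = 0 :> tensor R F ->
  exists (l : int) (s : R), ~~ (q%:Z %| l)%Z /\ (\sum_i y i *~ k i) *~ l = s *+ q.
Proof.
move=> qm ck yc0.
have : tensor_rel (\sum_i << (y i, c i) >> : {malg int[(R * F)%type]}).
  rewrite -[X in tensor_rel X]subr0; apply/tensor_piE.
  by rewrite raddf_sum raddf0.
case/tensor_rel_frac=> l [ql uP].
have /choice [g gP] : forall a, exists j, forall i,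
    frac_at a (l * m) i -> frac_at a (l * m) j.
  move=> a; have [[j aj]|no] := pselect (exists j, frac_at a (l * m) j).
    by exists j.
  by exists 0 => i ai; case: no; exists i.
have [s sE] := uP m qm g gP.
have /choice [t tE] : forall i, exists t : int, k i * l = g (c i) + t * q.
  move=> i; have ci : frac_at (c i) (l * m) (k i * l).
    by rewrite mulrC; apply: frac_atM.
  have /dvdzP[t tE] := frac_at_uniq ci (gP _ _ ci).
  by exists t; rewrite -tE addrC subrK.
exists l, (s + \sum_i y i *~ t i); split=> //.
rewrite mulrz_suml mulrnDl -sE raddf_sum -sumrMnl -big_split /=.
by apply: eq_bigr => i _; rewrite free_liftU -mulrzA tE mulrzDr mulrzA.
Qed.

End PrimeFunctional.

End CharField.

(** * Multilinear polynomials as coefficient vectors *)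

Definition perm_word n (s : 'S_n) : seq nat := [seq val (s i) | i <- enum 'I_n].

Lemma perm_word_inj n : injective (@perm_word n).
Proof.
move=> s t /eq_in_map st; apply/permP => i; apply: val_inj.
by apply: st; rewrite mem_enum.
Qed.

Lemma perm_wordE n (s : 'S_n) : perm_eq (perm_word s) (iota 0 n).
Proof.
rewrite -val_enum_ord /perm_word (map_comp val s); apply: perm_map.
apply: uniq_perm => [||i]; rewrite ?enum_uniq ?(map_inj_uniq perm_inj) ?enum_uniq //.
by rewrite mem_enum; apply/mapP; exists (s^-1%g i); rewrite ?mem_enum ?permKV.
Qed.

Section Coordinates.
Variables (k : comNzRingType) (n : nat).
Local Notation N := #|{: 'S_n}|.

Definition ml_coef (f : mlpoly k n) : 'rV[k]_N :=
  \row_i (ml_val f)@_(FMonom (perm_word (enum_val i))).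

Lemma ml_coef_is_linear : linear ml_coef.
Proof. by move=> a f g; apply/rowP => i; rewrite !mxE /= mcoeffD mcoeffZ. Qed.

HB.instance Definition _ :=
  GRing.isLinear.Build k (mlpoly k n) 'rV[k]_N *:%R ml_coef ml_coef_is_linear.

Lemma ml_valE (f : mlpoly k n) :
  ml_val f = \sum_i ml_coef f 0 i *: perm_monom k (enum_val i).
Proof.
case: f => f fP; case/asboolP: (fP) => c fE.
rewrite /ml_coef /= [LHS]fE (reindex_onto enum_val enum_rank) /=; last first.
  by move=> s _; rewrite enum_rankK.
apply: eq_big => [i|i _]; first by rewrite enum_valK eqxx.
rewrite mxE {}fE raddf_sum (bigD1 (enum_val i)) //= big1 ?addr0 => [|s si].
  by rewrite mcoeffZ mcoeffUU mulr1.
rewrite mcoeffZ mcoeffU; case: eqP => [[/perm_word_inj e]|_]; last by rewrite mulr0.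
by rewrite e eqxx in si.
Qed.

Lemma ml_coef_surj c : exists f, ml_coef f = c.
Proof.
have fP : \sum_i c 0 i *: perm_monom k (enum_val i) \in @multilinear k n.
  apply/asboolP; exists (fun s => c 0 (enum_rank s)).
  rewrite [RHS](reindex_onto enum_val enum_rank) /=; last first.
    by move=> s _; rewrite enum_rankK.
  by apply: eq_big => [i|i _]; rewrite enum_valK ?eqxx.
exists (MLPoly fP); apply/rowP => i.
rewrite mxE /= raddf_sum (bigD1 i) //= big1 ?addr0 => [|j ji].
  by rewrite mcoeffZ mcoeffUU mulr1.
rewrite mcoeffZ mcoeffU; case: eqP => [[/perm_word_inj/enum_val_inj e]|_].
  by rewrite e eqxx in ji.
by rewrite mulr0.
Qed.

Definition ml_eval (A : nuAlgType k) (a : nat -> A) (c : 'rV[k]_N) : A :=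
  \sum_i c 0 i *: word_eval a (perm_word (enum_val i)).

Lemma ml_eval_is_linear (A : nuAlgType k) (a : nat -> A) : linear (ml_eval a).
Proof.
move=> c u v; rewrite /ml_eval scaler_sumr -big_split; apply: eq_bigr => i _.
by rewrite !mxE scalerDl scalerA.
Qed.

HB.instance Definition _ (A : nuAlgType k) (a : nat -> A) :=
  GRing.isLinear.Build k 'rV[k]_N A *:%R (ml_eval a) (ml_eval_is_linear a).

(** For [n = 0] the monomial is the constant 1, which the free algebra without
    unit does not contain. *)
Lemma ml_idP (A : nuAlgType k) (f : mlpoly k n) : (0 < n)%N ->
  f \in @ml_id k A n <-> forall a : nat -> A, ml_eval a (ml_coef f) = 0.
Proof.
move=> n0; rewrite unfold_in.
have evalE (a : nat -> A) : nc_eval a (ml_val f) = ml_eval a (ml_coef f).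
  rewrite [ml_val f]ml_valE raddf_sum; apply: eq_bigr => i _.
  rewrite [LHS]linearZ_LR /= /perm_monom (nc_evalEw _ (@msuppU_le _ _ _ _)).
  by rewrite big_seq_fset1 mcoeffUU scale1r.
split=> [/asboolP[_ fP] a|fP]; first by rewrite -evalE.
apply/asboolP; split=> [|a]; last by rewrite evalE.
rewrite [ml_val f]ml_valE raddf_sum big1 // => i _.
rewrite /= mcoeffZ mcoeffU; case: eqP => [|_]; last by rewrite mulr0.
rewrite -[mone]/(fmone nat) fmoneE => -[/(congr1 size)].
by rewrite size_map size_enum_ord => n00; rewrite n00 in n0.
Qed.

End Coordinates.

(** * Maps induced on quotients *)

Section Quotient.
Variables (k : pzRingType) (V : lmodType k) (W : submodClosed V).

Lemma lmod_quot_lift (U : zmodType) (g : {additive V -> U}) :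
    (forall x, x \in W <-> g x = 0) -> (forall u, exists x, g x = u) ->
  exists2 f : {additive lmod_quot W -> U},
    bijective f & forall x, f (lmod_pi W x) = g x.
Proof.
move=> gW gsurj; pose f (x : lmod_quot W) := g (repr x).
have fE x : f (lmod_pi W x) = g x.
  apply/eqP; rewrite -subr_eq0 -raddfB; apply/eqP/gW.
  by apply/lmod_piE; rewrite lmod_piK.
have fB : zmod_morphism f.
  by move=> x y; rewrite -(lmod_piK x) -(lmod_piK y) -raddfB !fE raddfB.
pose f' : {additive lmod_quot W -> U} :=
  HB.pack f (GRing.isZmodMorphism.Build _ _ f fB).
exists f' => //; have [h hP] := choice gsurj.
exists (fun u => lmod_pi W (h u)) => [x|u]; last by rewrite /= fE hP.
rewrite -[RHS]lmod_piK; apply/lmod_piE/gW.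
by rewrite raddfB /= hP subrr.
Qed.

Lemma lmod_quot_lift_linear (U : lmodType k) (g : {linear V -> U}) :
    (forall x, x \in W <-> g x = 0) -> (forall u, exists x, g x = u) ->
  exists f : {linear lmod_quot W -> U}, bijective f.
Proof.
move=> gW gsurj; have [f fbij fE] := lmod_quot_lift gW gsurj.
have fL : linear f.
  move=> a x y; rewrite -(lmod_piK x) -(lmod_piK y) -linearZ -raddfD !fE.
  exact: (linearP g).
by exists (HB.pack_for {linear lmod_quot W -> U} (f : _ -> _)
  (GRing.isLinear.Build _ _ _ _ (f : _ -> _) fL)).
Qed.

End Quotient.

(** * Multilinear identities of a tensor product *)

Section WordEval.
Variables (k : comNzRingType) (A : nuAlgType k).
Implicit Types (a b : nat -> A) (w : seq nat).

Lemma word_eval_eq a b w : {in w, a =1 b} -> word_eval a w = word_eval b w.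
Proof.
case: w => // i w ab /=; rewrite (ab i) ?mem_head //.
have {ab}: {in w, a =1 b} by move=> j jw; apply: ab; rewrite inE jw orbT.
elim: w (b i) => //= j w IH x ab.
by rewrite ab ?mem_head // IH // => l lw; apply: ab; rewrite inE lw orbT.
Qed.

Lemma foldl_mulB a w (x y : A) :
  foldl (fun z i => z ** a i) (x - y) w =
  foldl (fun z i => z ** a i) x w - foldl (fun z i => z ** a i) y w.
Proof. by elim: w x y => //= i w IH x y; rewrite numulBl IH. Qed.

Lemma word_evalB a j (s t : A) w : uniq w -> j \in w ->
  word_eval [eta a with j |-> s - t] w =
  word_eval [eta a with j |-> s] w - word_eval [eta a with j |-> t] w.
Proof.
have foldl_eq u v x z : z \notin v ->
    foldl (fun y i => y ** [eta a with z |-> u] i) x v =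
    foldl (fun y i => y ** a i) x v.
  elim: v x => //= l v IH x; rewrite inE negb_or => /andP[zl zv].
  by rewrite eq_sym (negPf zl) IH.
case: w => // i w; rewrite /= inE => /andP[iw uw].
have [e _ | ji /= jw] := eqVneq j i.
  by rewrite -e in iw *; rewrite !foldl_eq // foldl_mulB.
case/splitPr: jw iw uw => u v _.
rewrite cat_uniq /= negb_or => /and3P[_ /andP[ju _] /andP[jv _]].
by rewrite !foldl_cat /= eqxx !foldl_eq // numulBr foldl_mulB.
Qed.

End WordEval.

Section Pure.
Variables (M N : zmodType).

Lemma pure0l (a : N) : pure (0 : M) a = 0.
Proof. by apply: (addrI (pure 0 a)); rewrite -pureDl !addr0. Qed.

Lemma pure0r (x : M) : pure x (0 : N) = 0.
Proof. by apply: (addrI (pure x 0)); rewrite -pureDr !addr0. Qed.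

Lemma pureNr (x : M) (a : N) : pure x (- a) = pure (- x) a.
Proof.
by apply: (addrI (pure x a)); rewrite -pureDr -pureDl !subrr pure0l pure0r.
Qed.

Lemma pureMn (x : M) (a : N) k : pure x (a *+ k) = pure (x *+ k) a.
Proof.
elim: k => [|k IH]; first by rewrite !mulr0n pure0l pure0r.
by rewrite !mulrS pureDl pureDr IH.
Qed.

Lemma pureMz (x : M) (a : N) (m : int) : pure x (a *~ m) = pure (x *~ m) a.
Proof. by case: m => k; rewrite ?NegzE ?mulrNz ?pureNr -!pmulrn pureMn ?mulNrn. Qed.

End Pure.

Section TensorIdentities.
Variables (R : nuRingType) (F : fieldType) (n : nat).
Local Notation N := #|{: 'S_n}|.
Local Notation T := (tensor_alg R F).

Definition perm_value (r : nat -> R) (i : 'I_N) : R :=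
  word_eval (r : nat -> zmodule R) (perm_word (enum_val i)).

Lemma word_eval_pure (r : nat -> R) (b : nat -> F) w :
  word_eval (fun i => pure (r i) (b i) : T) w =
  pure (word_eval (r : nat -> zmodule R) w : R) (\prod_(i <- w) b i).
Proof.
case: w => [|i w] /=; first by rewrite pure0l.
rewrite big_cons; elim: w (r i) (b i) => [|j w IH] x c /=.
  by rewrite big_nil mulr1.
rewrite -[(_ : T) ** _]/(tensor_mul _ _) tensor_mul_pure IH big_cons.
by rewrite mulrA.
Qed.

(** The scalars [b i] come out of every monomial in the same product, since a
    multilinear monomial contains each variable once. *)
Lemma ml_eval_pure (r : nat -> R) (b : nat -> F) (c : 'rV[F]_N) :
  ml_eval (fun i => pure (r i) (b i) : T) c =
  (\prod_(i < n) b i) *: (\sum_i pure (perm_value r i) (c 0 i) : T).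
Proof.
rewrite scaler_sumr; apply: eq_bigr => i _.
rewrite word_eval_pure -[LHS]/(tensor_scale _ _) -[RHS]/(tensor_scale _ _).
rewrite !tensor_scale_pure mulrC; congr (pure _ (_ * _)).
by rewrite (perm_big _ (perm_wordE _)) -[n in iota 0 n]subn0 big_mkord.
Qed.

(** Multilinear polynomials are additive in each variable, and pure tensors
    generate the tensor product; so identities need only be tested on pure
    tensors, where the scalars can be taken out. *)
Lemma ml_eval_tensorP (c : 'rV[F]_N) :
  (forall a : nat -> T, ml_eval a c = 0) <->
  (forall r : nat -> R, \sum_i pure (perm_value r i) (c 0 i) = 0 :> T).
Proof.
split=> [cP r|cP a].
  by have := ml_eval_pure r (fun=> 1) c; rewrite cP big1_eq scale1r => <-.
pose pureP (t : T) := exists r b, t = pure r b.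
(* replace the pure tensors by arbitrary ones, one variable at a time *)
suff pure_from j : forall a : nat -> T,
    (forall i, (j <= i)%N -> pureP (a i)) -> ml_eval a c = 0.
  pose a' i := if (i < n)%N then a i else pure 0 0.
  rewrite -(pure_from n a') => [|i]; last first.
    by rewrite leqNgt /a' => /negPf ->; exists 0, 0.
  apply: eq_bigr => i _; congr (_ *: _); apply: word_eval_eq => l.
  by rewrite (perm_mem (perm_wordE _)) mem_iota add0n /a' => /andP[_ ->].
elim: j => [|j IH] {}a aP.
  have /choice [r /choice [b ab]] : forall i, exists r b, a i = pure r b.
    by move=> i; apply: aP.
  by rewrite (funext ab) ml_eval_pure cP scaler0.
have aj : a = [eta a with j |-> a j].
  by apply: funext => i /=; case: eqP => // ->.
rewrite aj; elim/tensor_ind: (a j) => [|s t IHs IHt|r b].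
- by apply: IH => i ji /=; case: eqP => [_|/eqP ij]; [exists 0, 0; rewrite pure0l |
    apply: aP; rewrite ltn_neqAle eq_sym ij].
- have [jn|jn] := ltnP j n; last first.
    rewrite -[RHS]IHs; apply: eq_bigr => i _; congr (_ *: _).
    apply: word_eval_eq => l; rewrite (perm_mem (perm_wordE _)) mem_iota add0n /=.
    by move=> ln; case: eqP => // lj; rewrite lj ltnNge jn in ln.
  transitivity (ml_eval ([eta a with j |-> s] : nat -> T) c
    - ml_eval ([eta a with j |-> t] : nat -> T) c);
    last by rewrite IHs IHt subrr.
  rewrite -sumrB.
  apply: eq_bigr => i _; rewrite -scalerBr; congr (_ *: _); apply: word_evalB.
    by rewrite (perm_uniq (perm_wordE _)) iota_uniq.
  by rewrite (perm_mem (perm_wordE _)) mem_iota.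
- apply: IH => i ji /=; case: eqP => [_|/eqP ij]; first by exists r, b.
  by apply: aP; rewrite ltn_neqAle eq_sym ij.
Qed.

End TensorIdentities.

(** * Comparison of the two codimensions *)

(** The hypotheses on [I] are what the torsion ideal in characteristic 0 and [p R]
    in characteristic [p] have in common. *)
Section Codimension.
Variables (F : fieldType) (q : nat).
Hypothesis charF : forall m : int, (m%:~R == 0 :> F) = (q%:Z %| m)%Z.
Variables (R : nuRingType) (I : nuIdeal R) (n : nat).
Hypothesis Iq : forall x : R, x *+ q \in I.
Hypothesis Isat : forall (m : int) (x : R), ~~ (q%:Z %| m)%Z -> x *~ m \in I -> x \in I.
Hypothesis Ipure : forall x : R, x \in I -> pure x (1 : F) = 0.
Local Notation N := #|{: 'S_n}|.
Local Notation T := (tensor_alg R F).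
Local Notation toF := (map_mx (intr : int -> F)).

Definition int_relation (c : 'rV[int]_N) : Prop :=
  forall r : nat -> R, \sum_i perm_value r i *~ c 0 i \in I.

Lemma ml_eval_quotP (c : 'rV[int]_N) :
  (forall a : nat -> zmodule (nu_quot I), ml_eval a c = 0) <-> int_relation c.
Proof.
have word_pi (r : nat -> R) w :
    word_eval (nu_pi I \o r : nat -> zmodule (nu_quot I)) w =
    nu_pi I (word_eval (r : nat -> zmodule R) w).
  case: w => [|i w] /=; first by rewrite raddf0.
  by elim: w (r i) => //= j w IH x; rewrite -IH nu_piM.
have evalE (r : nat -> R) :
    ml_eval (nu_pi I \o r : nat -> zmodule (nu_quot I)) c =
    nu_pi I (\sum_i perm_value r i *~ c 0 i).
  rewrite raddf_sum; apply: eq_bigr => i _.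
  by rewrite word_pi scalezrE raddfMz.
have pi0 x : (nu_pi I x = 0) <-> (x \in I).
  by rewrite -(raddf0 (nu_pi I)) nu_piE subr0.
split=> [cP r|cP a]; first by apply/pi0; rewrite -evalE cP.
have -> : a = nu_pi I \o (fun i => repr (a i)).
  by apply: funext => i /=; rewrite nu_piK.
by rewrite evalE; apply/pi0.
Qed.

(** The integer coefficients pass to the first factor and leave an element of [I]
    tensored with 1. *)
Lemma int_relation_tensor (c : 'rV[int]_N) :
  int_relation c -> forall a : nat -> T, ml_eval a (toF c) = 0.
Proof.
move=> cP; apply/ml_eval_tensorP => r; rewrite -[RHS](Ipure (cP r)).
under eq_bigr do rewrite mxE pureMz.
elim/big_ind2: _ => [|x1 x2 y1 y2 -> ->|//].
  by rewrite pure0l.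
by rewrite pureDl.
Qed.

(** If [e = c v] were not zero, the numerators [k'] of the entries of [c] under a
    functional with value 1 at [e], taken with the common denominator [M], would
    form a vector of the lattice with [k' v] congruent to [M] modulo [q], hence
    not divisible by [q]. *)
Lemma tensor_relation_ortho (c : 'rV[F]_N) (v : 'cV[int]_N) :
    (forall l, int_relation l -> (q%:Z %| (l *m v) 0%R 0%R)%Z) ->
    (forall a : nat -> T, ml_eval a c = 0) ->
  c *m toF v = 0.
Proof.
move=> vL /ml_eval_tensorP cP; apply/rowP => z; rewrite ord1 [RHS]mxE.
apply/eqP/negPn/negP => e0; set e := (_ *m _) _ _ in e0.
have [H [H0 HB He Hfrac]] := maximal_avoiding charF e0.
have qM := char_dvdM charF.
have /choice [m /choice [k mkP]] := fun i => Hfrac (c 0 i).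
pose M := \prod_i m i.
have qM0 : ~~ (q%:Z %| M)%Z.
  rewrite -charF rmorph_prod; apply/prodf_neq0 => i _.
  by rewrite charF; case: (mkP i).
pose k' i := k i * \prod_(j | j != i) m j.
have ck' i : frac_at e H (c 0 i) M (k' i).
  by rewrite /M (bigD1 i) //=; apply: frac_atM => //; case: (mkP i).
have Lk : int_relation (\row_i k' i).
  move=> r; have [l [s [ql sE]]] := tensor_sum_frac charF H0 HB He Hfrac qM0 ck' (cP r).
  apply: (Isat ql); under eq_bigr do rewrite mxE.
  by rewrite sE.
have qk := vL _ Lk; move/negP: qM0; apply.
rewrite -[M](subrK ((\row_i k' i *m v) 0 0)); apply: rpredD qk.
apply: He; have -> : e *~ (M - (\row_i k' i *m v) 0 0) =
    \sum_i (c 0 i *~ M - e *~ k' i) *~ v i 0.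
  have eM : e *~ M = \sum_i c 0 i *~ M *~ v i 0.
    rewrite /e mxE mulrz_suml; apply: eq_bigr => i _.
    by rewrite mxE mulrzr -!mulrzA [M * _]mulrC.
  rewrite mulrzBr eM mxE mulrz_sumr -sumrB; apply: eq_bigr => i _.
  by rewrite mxE mulrzBl -!mulrzA.
elim/big_rec: _ => // i x _ Hx; apply: (avoidingD H0 HB) => //.
exact/(avoidingMz H0 HB)/ck'.
Qed.

(** With [P] and [J] from [lattice_coordinates], the coordinates of [c P] with
    index in [J] induce isomorphisms from both quotients: modulo [q] on integer
    vectors, and over [F] as they stand. *)
Lemma codim_tensor_quot :
    (0 < n)%N -> (q = 0%N \/ prime_power q) ->
  codim_alg (tensor_alg R F) n = codim_ring (nu_quot I) n q.
Proof.
move=> n0 qP.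
have [||| P [J [Punit LP]]] := @lattice_coordinates _ _ charF N int_relation.
- by move=> u v Lu Lv r; under eq_bigr do rewrite !mxE mulrzBr; rewrite sumrB rpredB.
- move=> u r; under eq_bigr do rewrite mxE mulrC mulrzA.
  by rewrite -mulrz_suml -pmulrn.
- move=> m u qm Lu r; apply: (Isat qm).
  rewrite mulrz_suml; have := Lu r; congr (_ \in I); apply: eq_bigr => i _.
  by rewrite mxE mulrC mulrzA.
(* the inverse of [P] is integral, so it remains an inverse of [P] over [F] *)
have PK : toF P *m toF (invmx P) = 1%:M by rewrite -map_mxM mulmxV // map_mx1.
have KP : toF (invmx P) *m toF P = 1%:M by rewrite -map_mxM mulVmx // map_mx1.
have WP (c : 'rV[F]_N) : (forall a : nat -> T, ml_eval a c = 0) <->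
    forall i, i \in J -> (c *m toF P) 0 i = 0.
  split=> [cW i iJ|cJ a].
    have /rowP/(_ 0) : c *m toF (col i P : 'cV_N) = 0.
      apply: tensor_relation_ortho cW => l /LP/(_ i iJ).
      by rewrite colE mulmxA -colE [col _ _ _ _]mxE.
    by rewrite map_col colE mulmxA -colE [col _ _ _ _]mxE => ->; rewrite mxE.
  (* [c] is a combination of the rows of [invmx P] with index outside [J], which
     are in the lattice *)
  rewrite -[c]mulmx1 -PK mulmxA mulmx_sum_row raddf_sum big1 // => i _ /=.
  have [iJ|iJ] := boolP (i \in J); first by rewrite cJ // scale0r raddf0.
  rewrite linearZ /= -map_row int_relation_tensor ?scaler0 //.
  apply/LP => j jJ; rewrite -row_mul mulVmx // !mxE.
  by case: eqP iJ => [->|]; rewrite ?jJ // dvdz0.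
transitivity #|J|.
  pose g (f : mlpoly F n) : 'rV[F]_#|J| :=
    \row_j (ml_coef f *m toF P) 0 (enum_val j).
  have gL : linear g.
    by move=> a x y; apply/rowP => j; rewrite [LHS]mxE linearP mulmxDl -scalemxAl !mxE.
  pose g' : {linear mlpoly F n -> 'rV[F]_#|J|} :=
    HB.pack g (GRing.isLinear.Build _ _ _ _ g gL).
  have [x|u|f fbij] := @lmod_quot_lift_linear F (mlpoly F n)
    (@ml_id F (tensor_alg R F) n) 'rV[F]_#|J| g'.
  - rewrite (ml_idP _ _ n0) WP; split=> [xJ|/rowP xJ i iJ].
      by apply/rowP => j; rewrite [LHS]mxE xJ ?mxE // enum_valP.
    have xi := xJ (enum_rank_in iJ i); rewrite [LHS]mxE enum_rankK_in // in xi.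
    by rewrite xi mxE.
  - (* extend [u] by 0 outside [J] *)
    have [x xE] := ml_coef_surj ((\row_i oapp (u 0) 0
      [pick j | enum_val j == i]) *m toF (invmx P)).
    exists x; apply/rowP => j; rewrite mxE xE -mulmxA KP mulmx1 mxE.
    by case: pickP => [l /eqP/enum_val_inj->|/(_ j)]; rewrite ?eqxx.
  exact: dimension_eq fbij.
pose g (f : mlpoly int n) : 'rV[cyclic_group q]_#|J| :=
  \row_j (cyc_gen q *~ (ml_coef f *m P) 0 (enum_val j)).
have gB : zmod_morphism g.
  by move=> x y; apply/rowP => j; rewrite [LHS]mxE raddfB mulmxBl !mxE mulrzBr.
pose g' : {additive mlpoly int n -> 'rV[cyclic_group q]_#|J|} :=
  HB.pack g (GRing.isZmodMorphism.Build _ _ g gB).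
have [x|u|f fbij _] := @lmod_quot_lift int (mlpoly int n)
  (@ml_id int (zmodule (nu_quot I)) n) _ g'.
- rewrite (ml_idP _ _ n0) ml_eval_quotP LP; split=> [xJ|/rowP xJ i iJ].
    apply/rowP => j; rewrite [LHS]mxE [RHS]mxE; apply/eqP.
    by rewrite cyc_gen_eq0 ?(char_neq1 charF) // xJ // enum_valP.
  have xi := xJ (enum_rank_in iJ i).
  rewrite [LHS]mxE [RHS]mxE enum_rankK_in // in xi.
  by move/eqP: xi; rewrite cyc_gen_eq0 ?(char_neq1 charF).
- have /choice [w wP] : forall j, exists m : int, u 0 j = cyc_gen q *~ m.
    by move=> j; apply: cyc_gen_surj.
  have [x xE] := ml_coef_surj ((\row_i oapp w 0
      [pick j | enum_val j == i]) *m invmx P).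
  exists x; apply/rowP => j; rewrite mxE xE mulmxKV // mxE wP.
  by case: pickP => [l /eqP/enum_val_inj->|/(_ j)]; rewrite ?eqxx.
exact/esym/(cyclic_multiplicity charF fbij qP).
Qed.

End Codimension.

Theorem theorem1 (R : nuRingType) (F : fieldType) (n : nat) (hn : (0 < n)%N) :
  ([pchar F]%R =i pred0 ->
     codim_alg (tensor_alg R F) n = codim_ring (mod_torsion R) n 0) /\
  (forall p : nat, p \in [pchar F]%R ->
     codim_alg (tensor_alg R F) n = codim_ring (mod_prime R p) n p).
Proof.
split=> [F0|p Fp].
  have natF0 := (GRing.pcharf0P F).1 F0.
  apply: codim_tensor_quot hn (or_introl erefl).
  - move=> m; rewrite dvd0z.
    by case: m => k; rewrite ?NegzE ?mulrNz ?oppr_eq0 -pmulrn natF0.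
  - by move=> x; rewrite mulr0n rpred0.
  - move=> m x; rewrite dvd0z => m0 /asboolP[k [k0 xmk]].
    apply/asboolP; exists (`|m| * k)%N; rewrite muln_gt0 absz_gt0 m0 k0; split=> //.
    case: m {m0} xmk => j; first by rewrite mulrnA.
    rewrite NegzE mulrNz -pmulrn mulNrn mulrnA => /eqP.
    by rewrite oppr_eq0 => /eqP.
  - move=> x /asboolP[k [k0 xk]].
    have kF : k%:R != 0 :> F by rewrite natF0 -lt0n.
    by rewrite -(mulVf kF) mulr_natr pureMn xk pure0l.
have p_pr := GRing.pcharf_prime Fp.
apply: codim_tensor_quot hn _.
- move=> m; rewrite -[RHS]/(p %| `|m|)%N (GRing.dvdn_pcharf Fp).
  by case: m => k; rewrite ?NegzE ?mulrNz ?oppr_eq0 -pmulrn.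
- by move=> x; apply/asboolP; exists x.
- move=> m x pm /asboolP[s xm]; apply/asboolP.
  have /coprimezP[[u v] /= uv] : coprimez m p.
    by rewrite coprimezE coprime_sym prime_coprime.
  exists (s *~ u + x *~ v).
  rewrite -[x in LHS]mulr1z -uv mulrzDr [u * m]mulrC !mulrzA xm mulrnDl.
  by rewrite !pmulrn -!mulrzA [_ * u]mulrC.
- move=> x /asboolP[s ->].
  by rewrite -pureMn (GRing.pcharf0 Fp) pure0r.
by right; exists p, 1%N; rewrite expn1.
Qed.
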